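(* (i) There is an instance $(G,c,D,r)$ with $m=|D|$ for which the MV-mTSP$_+$ with arbitrary tours (P5) and the MV-mTSP$_0$ with arbitrary tours (P7) have optimal solutions of different cost: $\mathsf{OPT}_{\mathrm{P5}}\neq\mathsf{OPT}_{\mathrm{P7}}$. (ii) There is an instance $(G,c,D,r)$ with $m=|D|$ for which the MV-mTSP$_+$ with disjoint tours (P6) and the MV-mTSP$_0$ with disjoint tours (P8) have optimal solutions of different cost: $\mathsf{OPT}_{\mathrm{P6}}\neq\mathsf{OPT}_{\mathrm{P8}}$.
   Context: Instance: a finite vertex set $V$; $G=(V,E)$ is the complete undirected graph on $V$, including a self-loop $vv$ at each $v$; symmetric costs $c(uv)\geq 0$ (self-loop costs $c(vv)$ are not assumed to be zero) that are metric: $c(uw)\leq c(uv)+c(vw)$ for all $u,v,w\in V$, and $c(vv)\leq 2\min_{u\in V\setminus\{v\}}c(uv)$ for all $v\in V$; a set of depots $D=\{d_1,\dots,d_m\}\subseteq V$, where $m=|D|\geq 1$ is the number of agents and $d_i$ is the depot of agent $i$; $\overline V=V\setminus D$; requests $r:\overline V\to\mathbb{Z}_{\geq 1}$. Depots have no requests. A multigraph is a multiset $X$ of edges (self-loops allowed) on $V$; $\operatorname{cost}(X)=\sum_{uv} x(uv)c(uv)$, where $x(uv)$ is the multiplicity of $uv$ in $X$. The degree $\dot\delta_X(v)$ counts each copy of the self-loop $vv$ twice. An MVTSP tour is a connected multigraph in which every degree is even; a multigraph with even degrees visits $v$ exactly $\dot\delta_X(v)/2$ times. Each agent's tour contains exactly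 one depot, namely the agent's own; a tour is non-empty if it contains a depot and at least one non-depot; an empty tour is an isolated depot. Each problem asks for a minimum-cost multigraph $X$ visiting each $v\in\overline V$ exactly $r(v)$ times, such that: (P5) the edge multiset of $X$ can be partitioned into exactly $m$ non-empty, not necessarily vertex-disjoint MVTSP tours; (P6) $X$ has exactly $m$ connected components, each a non-empty MVTSP tour; (P7) the edge multiset of $X$ can be decomposed into at most $m$ not necessarily vertex-disjoint MVTSP tours; (P8) $X$ has at most $m$ connected components (isolated depots being empty tours), each an MVTSP tour. Depots may be visited any number of times (at least once in P5 and P6). $\mathsf{OPT}_{\mathrm{P}i}$ denotes the cost of an optimal solution to P$i$ (the instances asserted to exist are ones on which both problems are feasible). *)

(* Defs.v *)
From HB Require Import structures.
From mathcomp Require Import all_boot all_order all_algebra.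

Set Implicit Arguments.
Unset Strict Implicit.
Unset Printing Implicit Defensive.

Import Order.TTheory GRing.Theory Num.Theory.

Local Open Scope ring_scope.

(* Edges of the complete undirected graph with self-loops on V: a self-loop   *)
(* vv is the singleton {v}, any other edge uv is the pair {u, v}.             *)
Definition edge (V : finType) := {e : {set V} | (0 < #|e| <= 2)%N}.

Lemma edge_of_subproof (V : finType) (u v : V) :
  (0 < #|[set u; v]| <= 2)%N.
Proof. by rewrite cards2; case: (u != v). Qed.

Definition edge_of (V : finType) (u v : V) : edge V :=
  exist _ [set u; v] (edge_of_subproof u v).

(* A multigraph is given by its edge multiplicities. *)
Definition multigraph (V : finType) := {ffun edge V -> nat}.

Definition degree (V : finType) (X : multigraph V) (v : V) : nat :=
  (\sum_(e : edge V | v \in val e) (if #|val e| == 1 then 2 else 1) * X e)%N.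

Definition adjacent (V : finType) (X : multigraph V) : rel V :=
  fun u v => (0 < X (edge_of u v))%N.

(* The multigraph (S, X) is an MVTSP tour.  The vertex set S is explicit so   *)
(* that an isolated vertex, which has no edge, is also a tour.                *)
Definition mvtsp_tour (V : finType) (S : {set V}) (X : multigraph V) : Prop :=
  [/\ S != set0,
      forall e : edge V, (0 < X e)%N -> val e \subset S,
      {in S &, forall u v, connect (adjacent X) u v}
    & forall v : V, ~~ odd (degree X v)].

(* The vertex sets of the connected components of (V, X), including those of  *)
(* isolated vertices.                                                         *)
Definition components (V : finType) (X : multigraph V) : {set {set V}} :=
  equivalence_partition (connect (adjacent X)) [set: V].

Definition induced (V : finType) (X : multigraph V) (S : {set V}) :
    multigraph V :=
  [ffun e : edge V => if val e \subset S then X e else 0%N].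

(* Agents are identified with their depots, so there are m = #|depots| of     *)
(* them.  The values of request on depots are irrelevant.                     *)
Record instance (R : realFieldType) := Instance {
  vertex :> finType;
  edge_cost : edge vertex -> R;
  depots : {set vertex};
  request : vertex -> nat;
  edge_cost_ge0 : forall e, 0 <= edge_cost e;
  edge_cost_triangle : forall u v w : vertex,
    edge_cost (edge_of u w)
      <= edge_cost (edge_of u v) + edge_cost (edge_of v w);
  edge_cost_loop : forall u v : vertex, u != v ->
    edge_cost (edge_of v v) <= 2 * edge_cost (edge_of u v);
  depots_gt0 : (0 < #|depots|)%N;
  request_gt0 : forall v : vertex, v \notin depots -> (0 < request v)%N
}.

Section Problems.

Variables (R : realFieldType) (I : instance R).
Implicit Types (X T : multigraph I) (S C A : {set I}) (d v : I).

Definition cost X : R := \sum_(e : edge I) (X e)%:R * edge_cost e.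

Definition meets_requests X : Prop :=
  forall v, v \notin depots I -> (degree X v)./2 = request v.

Definition agent_tour d S T : Prop :=
  mvtsp_tour S T /\ S :&: depots I = [set d].

Definition nonempty_agent_tour d S T : Prop :=
  agent_tour d S T /\ exists2 v, v \in S & v \notin depots I.

(* MV-mTSP_+ with arbitrary tours *)
Definition P5 X : Prop :=
  meets_requests X /\
  exists (S : I -> {set I}) (T : I -> multigraph I),
    (forall d, d \in depots I -> nonempty_agent_tour d (S d) (T d)) /\
    (forall e, X e = (\sum_(d in depots I) T d e)%N).

(* MV-mTSP_+ with disjoint tours *)
Definition P6 X : Prop :=
  [/\ meets_requests X,
      #|components X| = #|depots I|
    & forall C, C \in components X ->
        exists d, nonempty_agent_tour d C (induced X C)].

(* MV-mTSP_0 with arbitrary tours; A is the set of agents whose tours take    *)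
(* part in the decomposition.                                                 *)
Definition P7 X : Prop :=
  meets_requests X /\
  exists (A : {set I}) (S : I -> {set I}) (T : I -> multigraph I),
    [/\ A \subset depots I,
        forall d, d \in A -> agent_tour d (S d) (T d)
      & forall e, X e = (\sum_(d in A) T d e)%N].

(* MV-mTSP_0 with disjoint tours *)
Definition P8 X : Prop :=
  [/\ meets_requests X,
      (#|components X| <= #|depots I|)%N
    & forall C, C \in components X ->
        exists d, agent_tour d C (induced X C)].

Definition optimal (P : multigraph I -> Prop) X : Prop :=
  P X /\ forall Y, P Y -> cost X <= cost Y.

Definition is_OPT (P : multigraph I -> Prop) (x : R) : Prop :=
  exists2 X, optimal P X & cost X = x.

End Problems.

(* Main.v *)
Require Import Defs.
From mathcomp Require Import all_boot all_order all_algebra.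

(** Two depots [a], [b] and two requests [x], [y] (one visit each); the metric
    [c(uw) = [u = b] + [w = b]] puts [b] at distance 1 from three coincident
    points, so that the cost of a multigraph is its degree at [b].  Agent [a]
    can serve both requests at cost 0, whereas a non-empty tour of agent [b]
    leaves [b] and hence has positive even degree there.  The doubled edges
    [ax], [by] attain the resulting bound 2.  A feasible solution with disjoint
    tours is also one with arbitrary tours, so the same multigraphs are optimal
    for both kinds of tours. *)

Set Implicit Arguments.
Unset Strict Implicit.
Unset Printing Implicit Defensive.

Import GRing.Theory Num.Theory.

(** * Edges, degrees and connected components of multigraphs *)

Section Multigraphs.

Variable V : finType.
Implicit Types (X T : multigraph V) (S C : {set V}) (u v w : V) (e : edge V).

Lemma edge_ofC u v : edge_of u v = edge_of v u.
Proof. by apply: val_inj; rewrite /= setUC. Qed.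

Lemma edge_of_sub u v S : (val (edge_of u v) \subset S) = (u \in S) && (v \in S).
Proof. by rewrite /= subUset !sub1set. Qed.

Lemma edgeP e : exists u v, e = edge_of u v.
Proof.
have /andP[e0 e2] := valP e.
have [e1 | ne1] := eqVneq #|val e| 1.
  have /cards1P[u eu] := introT eqP e1.
  by exists u, u; apply: val_inj; rewrite /= setUid.
have /cards2P[u [v [_ euv]]] : #|val e| == 2.
  by rewrite eqn_leq e2 ltn_neqAle eq_sym ne1.
by exists u, v; apply: val_inj.
Qed.

Lemma adjacent_sym X : symmetric (adjacent X).
Proof. by move=> u v; rewrite /adjacent edge_ofC. Qed.

Lemma connect_adjacentC X : connect_sym (adjacent X).
Proof. exact/sym_connect_sym/adjacent_sym. Qed.

Lemma connect_adjacent_equiv X :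
  {in [set: V] & &, equivalence_rel (connect (adjacent X))}.
Proof.
move=> u v w _ _ _; split=> [|uv]; first exact: connect0.
exact: (same_connect (@connect_adjacentC X)).
Qed.

Lemma leq_degree X T v : (forall e, T e <= X e) -> degree T v <= degree X v.
Proof. by move=> leTX; apply: leq_sum => e _; rewrite leq_mul2l leTX orbT. Qed.

Lemma adjacent_degree_gt0 X u v : adjacent X u v -> 0 < degree X u.
Proof.
rewrite /adjacent => Xuv; rewrite /degree (bigD1 (edge_of u v)) /=.
  by rewrite ltn_addr // muln_gt0 Xuv andbT; case: ifP.
by rewrite set21.
Qed.

(** A path from [u] to another vertex starts with an edge at [u], so the degree is positive; being
    even, it is at least 2. *)
Lemma tour_degree_ge2 S T u v :
  mvtsp_tour S T -> u \in S -> v \in S -> u != v -> 1 < degree T u.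
Proof.
move=> [_ _ conn even] uS vS.
have /connectP[[|w s] /= uw ->] := conn _ _ uS vS; first by rewrite eqxx.
case/andP: uw => /adjacent_degree_gt0 + _ _.
by case: (degree T u) (even u) => [|[|]].
Qed.

Lemma componentsP X C :
  reflect (exists u, C = [set v | connect (adjacent X) u v])
          (C \in components X).
Proof.
apply: (iffP imsetP) => [[u _ ->]|[u ->]]; exists u => //;
  by apply/setP => v; rewrite !inE.
Qed.

Lemma component_adjacent X C u v :
  C \in components X -> adjacent X u v -> (u \in C) = (v \in C).
Proof.
case/componentsP=> w -> uv; rewrite !inE !(connect_adjacentC X w).
exact/(same_connect (@connect_adjacentC X))/connect1.
Qed.

(** The ends of an edge of [X] lie in the same component, so either end decides whether the whole
    edge lies in [C]. *)
Lemma component_edge X C e v :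
  C \in components X -> 0 < X e -> v \in val e ->
  (val e \subset C) = (v \in C).
Proof.
have [u [w ->]] := edgeP e => CX Xuw.
rewrite edge_of_sub (component_adjacent CX Xuw) andbb !inE.
by case/orP=> /eqP-> //; rewrite (component_adjacent CX Xuw).
Qed.

Lemma degree_induced X C v : C \in components X ->
  degree (induced X C) v = if v \in C then degree X v else 0.
Proof.
move=> CX; rewrite /degree; have [vC | vC] := ifP.
  apply: eq_bigr => e ve; rewrite ffunE.
  by case: (posnP (X e)) => [->|Xe]; rewrite ?if_same // (component_edge CX Xe ve) vC.
apply: big1 => e ve; rewrite ffunE.
case: (posnP (X e)) => [->|Xe]; first by rewrite if_same muln0.
by rewrite (component_edge CX Xe ve) vC muln0.
Qed.

(** A path of [X] that starts in [C] never leaves [C], hence survives in the induced multigraph;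
    degrees inside [C] are unchanged. *)
Lemma component_tour X C : (forall v, ~~ odd (degree X v)) ->
  C \in components X -> mvtsp_tour C (induced X C).
Proof.
move=> even CX; split.
- by case/componentsP: CX => u ->; apply/set0Pn; exists u; rewrite inE connect0.
- by move=> e; rewrite ffunE; case: ifP.
- move=> u v uC vC.
  have /connectP[s]: connect (adjacent X) u v.
    case/componentsP: CX uC vC => w ->; rewrite !inE connect_adjacentC.
    exact: connect_trans.
  elim: s u uC => [u _ _ -> | w s IHs u uC /= /andP[uw ws] def_v].
    exact: connect0.
  have wC: w \in C by rewrite -(component_adjacent CX uw).
  apply: connect_trans (IHs w wC ws def_v); apply: connect1.
  by rewrite /adjacent ffunE edge_of_sub uC wC.
- by move=> v; rewrite degree_induced //; case: ifP.
Qed.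

End Multigraphs.

(** * From disjoint tours to arbitrary tours, and the degree bound at depots *)

Section Problems.

Variables (R : realFieldType) (I : instance R).
Implicit Types (X : multigraph I) (C : {set I}) (d : I).

Definition component_of X d : {set I} := [set v | connect (adjacent X) d v].

Lemma component_of_components X d : component_of X d \in components X.
Proof. by apply/componentsP; exists d. Qed.

Lemma depot_component X d C : d \in depots I -> d \in C ->
  (exists d', agent_tour d' C (induced X C)) ->
  C :&: depots I = [set d].
Proof.
move=> dD dC [d' [_ Cd']]; rewrite Cd'; congr [set _].
by apply/esym/eqP; rewrite -in_set1 -Cd' inE dC.
Qed.

(** Each edge of [X] lies in a single component, and that component contains a single depot, so
    exactly one summand counts the edge. *)
Lemma component_decomposition X :
  (forall C, C \in components X -> exists d, agent_tour d C (induced X C)) ->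
  forall e, X e = \sum_(d in depots I) induced X (component_of X d) e.
Proof.
move=> tours e; have [u [v def_e]] := edgeP e.
case: (posnP (X e)) => [Xe0 | Xe].
  by rewrite Xe0 big1 // => d _; rewrite ffunE Xe0 if_same.
have ue : u \in val e by rewrite def_e set21.
have uX := component_of_components X u.
have [d [_ ud]] := tours _ uX.
have /setIP[du dD] : d \in component_of X u :&: depots I by rewrite ud set11.
(* By symmetry of connectedness, the depots whose component contains [e] are those in the component
   of [u]. *)
have sub d' : (val e \subset component_of X d') = (d' \in component_of X u).
  rewrite (component_edge (component_of_components _ _) Xe ue) !inE.
  exact: connect_adjacentC.
rewrite (bigD1 d) //= ffunE sub du big1 ?addn0 // => d' /andP[d'D].
apply: contraNeq; rewrite ffunE sub; case: ifP => // d'u _.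
by rewrite -in_set1 -ud inE d'u.
Qed.

Lemma P6_P5 X : P6 X -> P5 X.
Proof.
case=> req _ tours; split=> //.
exists (component_of X), (fun d => induced X (component_of X d)); split.
  move=> d dD; have dX := component_of_components X d.
  have [d' [tour ne]] := tours _ dX; have [mv _] := tour; split=> //; split=> //.
  apply: (@depot_component X) => //; last by exists d'.
  by rewrite inE connect0.
apply: component_decomposition => C /tours[d [tour _]].
by exists d.
Qed.

Lemma P8_P7 X : P8 X -> P7 X.
Proof.
case=> req _ tours; split=> //.
(* Every agent takes part; a depot at which [X] has no edge contributes a tour without edges. *)
exists (depots I), (component_of X), (fun d => induced X (component_of X d)).
split=> //; last exact: component_decomposition.
move=> d dD; have dX := component_of_components X d.
have [d' [tour _]] := tours _ dX; split=> //.
apply: (@depot_component X) => //; last exact: tours.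
by rewrite inE connect0.
Qed.

(** The tour of agent [d] also contains a non-depot, so it has degree at least 2 at [d], and its
    edges are among those of [X]. *)
Lemma P5_degree_ge2 X d : P5 X -> d \in depots I -> 1 < degree X d.
Proof.
move=> [_ [S [T [tours XE]]]] dD.
have [[tour Sd] [v vS vD]] := tours d dD.
have /setIP[dS _] : d \in S d :&: depots I by rewrite Sd set11.
have dv : d != v by apply: contraNneq vD => <-.
apply: leq_trans (tour_degree_ge2 tour dS vS dv) (leq_degree _ _) => e.
by rewrite XE (bigD1 d) //= leq_addr.
Qed.

End Problems.

(** * Forests of stars with doubled edges, given by an idempotent map sending each vertex to the
    centre of its star *)

Section StarForest.

Variables (V : finType) (p : V -> V).
Hypothesis pK : forall v, p (p v) = p v.

(* Every vertex v that is not a fixpoint of p is joined to p v by two edges. *)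
Definition star_forest : multigraph V :=
  [ffun e => \sum_(w | p w != w) 2 * (e == edge_of w (p w))].

Lemma degree_star_forest v :
  degree star_forest v = 2 * \sum_(w | p w != w) (v \in [set w; p w]).
Proof.
rewrite /degree big_distrr /=.
under [LHS]eq_bigr do rewrite ffunE big_distrr /=.
rewrite exchange_big /=; apply: eq_bigr => w pw.
(* The term of [w] is supported on its own edge, which is not a loop because [p w != w]. *)
rewrite big_mkcond (bigD1 (edge_of w (p w))) //= big1 => [|e /negPf->].
  by rewrite addn0 eqxx cards2 [w == _]eq_sym pw /=; case: (v \in _).
by rewrite !muln0 if_same.
Qed.

Lemma even_degree_star_forest v : ~~ odd (degree star_forest v).
Proof. by rewrite degree_star_forest mul2n odd_double. Qed.

(** By idempotence a vertex moved by [p] is not the centre of any star, so it only meets its own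
    doubled edge. *)
Lemma degree_star_forest_leaf v : p v != v -> degree star_forest v = 2.
Proof.
move=> pv; rewrite degree_star_forest (bigD1 v) //= set21 big1 // => w /andP[_ wv].
rewrite !inE eq_sym (negPf wv) /=; case: eqP => // vpw.
by rewrite vpw pK eqxx in pv.
Qed.

Lemma adjacent_star_forest v : p v != v -> adjacent star_forest v (p v).
Proof. by move=> pv; rewrite /adjacent ffunE (bigD1 v) //= eqxx. Qed.

Lemma star_forest_adjacent u v : adjacent star_forest u v -> p u = p v.
Proof.
rewrite /adjacent ffunE lt0n sum_nat_eq0 negb_forall => /existsP[w].
rewrite negb_imply => /andP[_]; rewrite muln_eq0 /= eqb0 negbK => /eqP uv.
have star x : x \in val (edge_of u v) -> p x = p w.
  by rewrite uv !inE => /orP[] /eqP->.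
by rewrite !star //= ?set21 ?set22.
Qed.

(** The map [p] is constant along edges; conversely every vertex equals its centre or is adjacent to
    it. *)
Lemma connect_star_forest u v : connect (adjacent star_forest) u v = (p u == p v).
Proof.
apply/idP/eqP => [/connectP[s] | puv].
  elim: s u => [u _ -> // | w s IHs u /= /andP[/star_forest_adjacent-> ws] def_v].
  exact: IHs.
have root w : connect (adjacent star_forest) w (p w).
  have [pw | pw] := eqVneq (p w) w; first by rewrite pw connect0.
  exact/connect1/adjacent_star_forest.
apply: connect_trans (root u) _.
by rewrite puv connect_adjacentC.
Qed.

Lemma components_star_forest :
  components star_forest = [set p @^-1: [set d] | d in p @: [set: V]].
Proof.
apply/setP => C; apply/componentsP/imsetP => [[u ->] | [d /imsetP[u _ ->] ->]].
  exists (p u); first exact: imset_f.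
  by apply/setP => v; rewrite !inE connect_star_forest eq_sym.
by exists u; apply/setP => v; rewrite !inE connect_star_forest eq_sym.
Qed.

(** Fibres over distinct points of the image are distinct because they are non-empty. *)
Lemma card_components_star_forest :
  #|components star_forest| = #|p @: [set: V]|.
Proof.
rewrite components_star_forest; apply: card_in_imset => _ d /imsetP[u _ ->] _ /setP eqC.
by have := eqC u; rewrite !inE eqxx => /esym/eqP.
Qed.

End StarForest.

(** * Star forests centred at the depots as feasible solutions *)

Section StarForestSolutions.

Variables (R : realFieldType) (I : instance R) (p : I -> I).
Hypothesis pK : forall v, p (p v) = p v.
Hypothesis depotsE : forall v, (v \in depots I) = (p v == v).
Hypothesis request1 : forall v, v \notin depots I -> request v = 1.

Lemma meets_requests_star_forest : meets_requests (star_forest p).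
Proof.
move=> v vD; rewrite degree_star_forest_leaf ?request1 //.
by rewrite -depotsE.
Qed.

Lemma depots_imset : depots I = p @: [set: I].
Proof.
apply/setP => v; rewrite depotsE; apply/eqP/imsetP => [pv | [u _ ->]].
  by exists v.
exact: pK.
Qed.

(** The fibre over [d] is a component, and [d] is the only fixpoint of [p], hence the only depot, in
    it. *)
Lemma agent_tour_star_forest d : d \in depots I ->
  let C := p @^-1: [set d] in agent_tour d C (induced (star_forest p) C).
Proof.
move=> dD C; split.
  apply: component_tour; first exact: even_degree_star_forest.
  by rewrite components_star_forest // -depots_imset imset_f.
apply/setP => v; rewrite !inE depotsE; apply/andP/eqP => [[/eqP-> /eqP //]|->].
by rewrite -depotsE dD; split=> //; rewrite -depotsE.
Qed.

Lemma P8_star_forest : P8 (star_forest p).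
Proof.
split; first exact: meets_requests_star_forest.
  by rewrite card_components_star_forest // -depots_imset.
move=> C; rewrite components_star_forest // -depots_imset => /imsetP[d dD ->].
by exists d; apply: agent_tour_star_forest.
Qed.

Lemma P6_star_forest :
  (forall d, d \in depots I -> exists2 v, v \notin depots I & p v = d) ->
  P6 (star_forest p).
Proof.
move=> leaf; split; first exact: meets_requests_star_forest.
  by rewrite card_components_star_forest // -depots_imset.
move=> C; rewrite components_star_forest // -depots_imset => /imsetP[d dD ->].
exists d; split; first exact: agent_tour_star_forest.
by have [v vD pv] := leaf d dD; exists v; rewrite // !inE pv.
Qed.

End StarForestSolutions.

Local Open Scope ring_scope.

(** * The instance with a remote depot and its optimal values *)

Section Counterexample.

Variable R : realFieldType.

(* (i, true) is a depot and (i, false) a request; the remote depot b is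
   (true, true). *)
Let V : finType := (bool * bool)%type.
Let b : V := (true, true).

(** This is the contribution of [e] to the degree at [b]. As the cast of a natural number, it
    reduces the metric axioms to a case check in [nat]. *)
Definition remote_cost (e : edge V) : R :=
  (if b \in val e then if #|val e| == 1 then 2 else 1 else 0)%N%:R.

Lemma remote_cost_edge_of u v :
  remote_cost (edge_of u v) = ((u == b) + (v == b))%N%:R.
Proof.
rewrite /remote_cost /= cards2 !inE ![b == _]eq_sym.
have [->|ub] := eqVneq u b; first by case: eqVneq.
by have [->|_] := eqVneq v b; rewrite ?ub.
Qed.

Lemma remote_cost_ge0 e : 0 <= remote_cost e.
Proof. exact: ler0n. Qed.

Lemma remote_cost_triangle u v w : remote_cost (edge_of u w)
  <= remote_cost (edge_of u v) + remote_cost (edge_of v w).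
Proof.
rewrite !remote_cost_edge_of -natrD ler_nat.
by case: (u == b); case: (v == b); case: (w == b).
Qed.

Lemma remote_cost_loop u v : u != v ->
  remote_cost (edge_of v v) <= 2 * remote_cost (edge_of u v).
Proof.
move=> _; rewrite !remote_cost_edge_of -natrM ler_nat.
by case: (u == b); case: (v == b).
Qed.

Definition remote_depots : {set V} := [set v | v.2].

Lemma remote_depots_gt0 : (0 < #|remote_depots|)%N.
Proof. by apply/card_gt0P; exists b; rewrite inE. Qed.

Definition remote_instance : instance R :=
  @Instance R V remote_cost remote_depots (fun=> 1%N) remote_cost_ge0
    remote_cost_triangle remote_cost_loop remote_depots_gt0
    (fun _ _ => isT).

Let I := remote_instance.

Lemma cost_remote (X : multigraph I) : cost X = (degree X b)%:R.
Proof.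
rewrite /cost /degree natr_sum [RHS]big_mkcond /=; apply: eq_bigr => e _.
by rewrite /remote_cost; case: ifP => _; rewrite ?mulr0 // natrM mulrC.
Qed.

(** Two choices of star centres: [own_depot] gives each depot one request, whereas [near_depot]
    sends both requests to the depot [(false, true)] and leaves [b] isolated. *)
Definition own_depot (v : V) : V := (v.1, true).
Definition near_depot (v : V) : V := if v.2 then v else (false, true).

Lemma P6_own_depot : P6 (star_forest own_depot : multigraph I).
Proof.
apply: P6_star_forest => //.
- by move=> [i [|]]; rewrite inE /own_depot /= xpair_eqE eqxx.
- move=> [i k]; rewrite inE /= => k1; rewrite k1.
  by exists (i, false); rewrite ?inE.
Qed.

Lemma P8_near_depot : P8 (star_forest near_depot : multigraph I).
Proof.
by apply: P8_star_forest => // [[i [|]]|[i [|]]] //; rewrite !inE /near_depot /=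
  ?eqxx // xpair_eqE andbF.
Qed.

Lemma cost_own_depot : cost (star_forest own_depot : multigraph I) = 2.
Proof.
(* The request [(true, false)] is the only leaf joined to [b]. *)
rewrite cost_remote degree_star_forest (bigD1 (true, false)) //= set22.
rewrite big1 // => -[i k]; rewrite /own_depot !inE !xpair_eqE.
by case: i; case: k.
Qed.

Lemma cost_near_depot : cost (star_forest near_depot : multigraph I) = 0.
Proof.
rewrite cost_remote degree_star_forest big1 // => -[i k].
by rewrite /near_depot !inE; case: i; case: k.
Qed.

Lemma P5_cost_ge2 (X : multigraph I) : P5 X -> 2 <= cost X.
Proof.
move=> X5; rewrite cost_remote ler_nat.
by apply: P5_degree_ge2 => //; rewrite inE.
Qed.

Lemma cost_remote_ge0 (X : multigraph I) : 0 <= cost X.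
Proof. by rewrite cost_remote ler0n. Qed.

Lemma OPT5_remote : is_OPT (@P5 R I) 2.
Proof.
exists (star_forest own_depot); last exact: cost_own_depot.
split=> [|X /P5_cost_ge2]; first exact/P6_P5/P6_own_depot.
by rewrite cost_own_depot.
Qed.

Lemma OPT6_remote : is_OPT (@P6 R I) 2.
Proof.
exists (star_forest own_depot); last exact: cost_own_depot.
split=> [|X /P6_P5/P5_cost_ge2]; first exact: P6_own_depot.
by rewrite cost_own_depot.
Qed.

Lemma OPT7_remote : is_OPT (@P7 R I) 0.
Proof.
exists (star_forest near_depot); last exact: cost_near_depot.
split=> [|X _]; first exact/P8_P7/P8_near_depot.
by rewrite cost_near_depot cost_remote_ge0.
Qed.

Lemma OPT8_remote : is_OPT (@P8 R I) 0.
Proof.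
exists (star_forest near_depot); last exact: cost_near_depot.
split=> [|X _]; first exact: P8_near_depot.
by rewrite cost_near_depot cost_remote_ge0.
Qed.

End Counterexample.

Local Close Scope ring_scope.

Theorem claim2p8 (R : realFieldType) :
  (exists (I : instance R) (OPT5 OPT7 : R),
     [/\ is_OPT (@P5 R I) OPT5, is_OPT (@P7 R I) OPT7 & OPT5 <> OPT7]) /\
  (exists (I : instance R) (OPT6 OPT8 : R),
     [/\ is_OPT (@P6 R I) OPT6, is_OPT (@P8 R I) OPT8 & OPT6 <> OPT8]).
Proof.
have two_neq0 : 2%R <> 0%R :> R by apply/eqP; rewrite pnatr_eq0.
split; exists (remote_instance R), 2%R, 0%R; split=> //.
- exact: OPT5_remote.
- exact: OPT7_remote.
- exact: OPT6_remote.
- exact: OPT8_remote.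
Qed.
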